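(* Consider $\dot x=f(x,u(t))$ on $\mathbb R^{2N}$, semi-contracting on $\mathcal D\subseteq\mathbb R^{2N}$ with respect to $\|\cdot\|_R$ with rate $c>0$. Let $\mathcal U$ be an admissible input set (in which $u(t)$ takes its values) on which there exists a continuously differentiable quasi-steady map $x^*:\mathcal U\to\mathcal D$ satisfying $$\|f(x^*(u),u)\|_R=0,\qquad \Big\|\frac{\partial x^*}{\partial u}(u)\Big\|_R\le H,$$ for all $u\in\mathcal U$, where $H>0$ is a uniform sensitivity bound. Under the slow-variation condition $\|\dot u(t)\|_2\le\epsilon$, the trajectory $x(t)$ relative to $x_c(t):=x^*(u(t))$ satisfies, for all $t\ge0$, $$\inf_{v\in\ker(R)}\|x(t)-(x_c(t)+v)\|_R\le e^{-ct}\rho(0)+\frac{H\epsilon}{c}\big(1-e^{-ct}\big),$$ where $\rho(0)\ge\inf_{v\in\ker(R)}\|x(0)-(x_c(0)+v)\|_R$. Consequently, $$\limsup_{t\to\infty}\ \inf_{v\in\ker(R)}\|x(t)-(x_c(t)+v)\|_R\le\frac{H\epsilon}{c}.$$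
   Context: $N\ge2$. $R_\theta\in\mathbb R^{(N-1)\times N}$ has orthonormal rows spanning $\mathrm{span}\{\mathbf 1_N\}^\perp$; $R:=\mathrm{blkdiag}(R_\theta,I_N)\in\mathbb R^{(2N-1)\times2N}$; $\|x\|_R:=\|Rx\|_2$ is a seminorm on $\mathbb R^{2N}$ with kernel $\ker(R)=\mathrm{span}\{[\mathbf 1_N^\top,\mathbf 0_N^\top]^\top\}$. Inputs $u$ take values in $\mathbb R^{2N}$. For the matrix $\frac{\partial x^*}{\partial u}$ (acting on input space with the Euclidean norm), $\|M\|_R:=\sup_{\|w\|_2=1}\|Mw\|_R$. $f(x,u)$ is continuously differentiable in $x\in\mathbb R^{2N}$ with Jacobian $D_xf(x,u)$. For $A\in\mathbb R^{2N\times2N}$ regarded as an operator on state space, $\|A\|_R:=\max\{\|Az\|_R: z\perp\ker(R),\ \|z\|_R=1\}$ and $\mu_R(A):=\lim_{h\to0^+}\frac{\|I+hA\|_R-1}{h}$, which equals $\lambda_{\max}\big(\tfrac12(RAR^\top+RA^\top R^\top)\big)$. The domain $\mathcal D$ is convex, and semi-contracting on $\mathcal D$ with rate $c>0$ with respect to $\|\cdot\|_R$ means $\mu_R(D_xf(x,u(t)))\le -c$ for all $x\in\mathcal D$, $t\ge0$. Standing property of the systems considered: $D_xf(x,u(t))\ker(R)\subseteq\ker(R)$ for all $x\in\mathcal D$, $t\ge0$. The input $u(t)$ is differentiable in time (almost everywhere, and absolutely continuous), and $x(t)$ denotes a solution of $\dot x=f(x,u(t))$.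
   Formalization: The formal theorem additionally assumes that the trajectory x(t) stays in the domain D for all t ≥ 0; without this the claim fails, since the dynamics outside D may be expanding. *)

(* Defs.v *)
From HB Require Import structures.
From mathcomp Require Export all_boot all_order all_algebra.
From mathcomp Require Export all_classical all_reals all_analysis.
Set Implicit Arguments.
Unset Strict Implicit.
Unset Printing Implicit Defensive.
Import Order.TTheory GRing.Theory Num.Theory.
Import numFieldNormedType.Exports.
Local Open Scope classical_set_scope.
Local Open Scope ring_scope.

(* The norm `|_| that the library puts on matrices is the sup norm, so the
   Euclidean norm is defined here.  The topology and the notion of
   differentiability are the same for both norms. *)
Definition enorm (K : realType) (n : nat) (x : 'cV[K]_n) : K :=
  Num.sqrt (\sum_i x i 0 ^+ 2).

Definition snorm (K : realType) (m n : nat) (S : 'M[K]_(m, n))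
    (x : 'cV[K]_n) : K :=
  enorm (S *m x).

Definition kerset (K : realType) (m n : nat) (S : 'M[K]_(m, n)) :
    set 'cV[K]_n :=
  [set v | S *m v = 0].

(* R = blkdiag(R_theta, I_N) *)
Definition Rmx (K : realType) (N : nat) (Rth : 'M[K]_(N.-1, N)) :
    'M[K]_(N.-1 + N, N + N) :=
  block_mx Rth 0 0 1%:M.

(* Orthonormal rows whose span is {w | w . 1_N = 0}; in the row-space calculus
   the latter is the (left) kernel of the all-ones column vector. *)
Definition orthonormal_basis_ones_perp (K : realType) (N : nat)
    (Rth : 'M[K]_(N.-1, N)) : Prop :=
  Rth *m Rth^T = 1%:M /\ (Rth == kermx (const_mx 1 : 'cV[K]_N))%MS.

(* Euclidean norm on the inputs, seminorm on the values: |d x*/d u|_R. *)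
Definition op_norm_to_snorm (K : realType) (m n p : nat) (S : 'M[K]_(m, n))
    (M : 'M[K]_(n, p)) : K :=
  sup [set snorm S (M *m w) | w in [set w : 'cV[K]_p | enorm w = 1]].

(* The supremum is a maximum: {z | z _|_ ker S, |z|_S = 1} is compact. *)
Definition op_snorm (K : realType) (m n : nat) (S : 'M[K]_(m, n))
    (A : 'M[K]_n) : K :=
  sup [set snorm S (A *m z) | z in
        [set z : 'cV[K]_n |
          (forall v, kerset S v -> z^T *m v = 0) /\ snorm S z = 1]].

Definition log_snorm (K : realType) (m n : nat) (S : 'M[K]_(m, n))
    (A : 'M[K]_n) : K :=
  lim ((fun h : K => (op_snorm S (1%:M + h *: A) - 1) / h) @ 0^'+).

(* Jacobian acting on column vectors (the library's 'J is for row vectors and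
   acts from the right). *)
Definition jac (K : realType) (n p : nat) (g : 'cV[K]_p -> 'cV[K]_n)
    (x : 'cV[K]_p) : 'M[K]_(n, p) :=
  \matrix_(i < n, j < p) ('D_(delta_mx j 0) g x) i 0.

(* For open A this is C^1 on A.  For other A, g is a map on the whole space
   with two-sided derivatives at the points of A; this holds as soon as g is
   C^1 on an open neighbourhood of A. *)
Definition C1_on (K : realType) (n p : nat) (A : set 'cV[K]_p)
    (g : 'cV[K]_p -> 'cV[K]_n) : Prop :=
  (forall x, A x -> differentiable g x) /\ {within A, continuous (jac g)}.

(* Absolute continuity on every compact interval [0, T].  The family of disjoint
   intervals is given in increasing order, [a i, b i] for i < k. *)
Definition loc_abs_cont (K : realType) (n : nat) (g : K -> 'cV[K]_n) : Prop :=
  forall T e : K, 0 < e -> exists2 d : K, 0 < d &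
    forall (k : nat) (a b : nat -> K),
      (forall i, (i < k)%N -> 0 <= a i /\ a i <= b i /\ b i <= T) ->
      (forall i, (i.+1 < k)%N -> b i <= a i.+1) ->
      \sum_(i < k) (b i - a i) < d ->
      \sum_(i < k) enorm (g (b i) - g (a i)) < e.

Definition semi_contracting (K : realType) (m n p : nat) (S : 'M[K]_(m, n))
    (f : 'cV[K]_n -> 'cV[K]_p -> 'cV[K]_n) (u : K -> 'cV[K]_p)
    (D : set 'cV[K]_n) (c : K) : Prop :=
  forall x t, D x -> 0 <= t -> log_snorm S (jac (f ^~ (u t)) x) <= - c.

Definition preserves_kernel (K : realType) (m n p : nat) (S : 'M[K]_(m, n))
    (f : 'cV[K]_n -> 'cV[K]_p -> 'cV[K]_n) (u : K -> 'cV[K]_p)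
    (D : set 'cV[K]_n) : Prop :=
  forall x t v, D x -> 0 <= t -> kerset S v ->
    kerset S (jac (f ^~ (u t)) x *m v).

(* Caratheodory solution on [0, +oo[ *)
Definition solution (K : realType) (n p : nat)
    (f : 'cV[K]_n -> 'cV[K]_p -> 'cV[K]_n) (u : K -> 'cV[K]_p)
    (x : K -> 'cV[K]_n) : Prop :=
  loc_abs_cont x /\
  {ae @lebesgue_measure K, forall t : K, 0 <= t ->
    derivable x t 1 /\ 'D_1 x t = f (x t) (u t)}.

Definition ker_dist (K : realType) (m n : nat) (S : 'M[K]_(m, n))
    (x y : 'cV[K]_n) : K :=
  inf [set snorm S (x - (y + v)) | v in kerset S].

(* Main.v *)
(* Since R v = 0 on ker R, the infimum over v is just V(t) = |R (x(t) - x*(u(t)))|.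

   u is eps-Lipschitz (absolutely continuous with |u'| <= eps a.e.), so R x*(u(.))
   has Dini derivative at most H eps at EVERY t, which makes it H eps-Lipschitz
   without any assumption on the shape of U.  The mean value theorem on the segment
   from x*(u(t)) to x(t), with xi = R (x(t) - x*(u(t))), gives
   <xi, R (f(x,u) - f(x*(u),u))> <= -c |xi|^2, because the kernel component of the
   chord is killed by R J.  Hence D^+ V <= -c V + H eps for almost every t, so that
   e^{ct} (V - H eps / c) is absolutely continuous with nonpositive Dini derivative
   a.e., hence nonincreasing.

   That an absolutely continuous function with nonpositive Dini derivative a.e. is
   nonincreasing is proved by covering the exceptional null set by an open
   set G of small measure and adding e t + W(t) to the comparison function, W(t) being
   the variation inside G up to time t: it is small by absolute continuity, and it
   absorbs the increments at the points of G. *)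
From mathcomp Require Import ring lra.
Require Import Defs.
Set Implicit Arguments.
Unset Strict Implicit.
Unset Printing Implicit Defensive.
Import Order.TTheory GRing.Theory Num.Theory.
Import numFieldNormedType.Exports.
Local Open Scope classical_set_scope.
Local Open Scope ring_scope.

(** * Absolutely continuous functions and Dini derivatives *)

Definition right_upper_dini_le {K : realType} (phi : K -> K) (t l : K) : Prop :=
  forall e : K, 0 < e -> exists2 d : K, 0 < d &
    forall s, t < s -> s < t + d -> phi s - phi t <= (l + e) * (s - t).

(** The supremum of the points up to which the inequality holds from [a] is itself such a point:
    [phi] is continuous there, and [W], which may jump, can only grow when the supremum is
    approached from the left. The local hypothesis then pushes any such point below [b] further to
    the right. *)
Lemma real_induction_le {K : realType} (phi W : K -> K) (a b e : K) :
  a <= b ->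
  (forall t, a <= t <= b -> forall e', 0 < e' -> exists2 d, 0 < d &
     forall s, a <= s <= b -> `|s - t| < d -> `|phi s - phi t| < e') ->
  (forall s t, a <= s -> s <= t -> t <= b -> W s <= W t) ->
  0 <= e ->
  (forall t, a <= t < b -> exists2 d, 0 < d & forall s, t < s -> s < t + d ->
     s <= b -> phi s - phi t <= W s - W t + e * (s - t)) ->
  phi b - phi a <= W b - W a + e * (b - a).
Proof.
move=> ab phic Wle e0 step.
pose S := [set s | a <= s <= b /\ phi s - phi a <= W s - W a + e * (s - a)].
have Sa : S a by split; [rewrite lexx ab | rewrite !subrr mulr0 addr0].
have ubS : has_ubound S by exists b => s [/andP[]].
have hsS : has_sup S by split; [exists a|].
set s0 := sup S.
have as0 : a <= s0 by exact: ub_le_sup.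
have s0b : s0 <= b by apply: ge_sup; [exists a | move=> s [/andP[]]].
have Ss0 : S s0.
  split; first by rewrite as0 s0b.
  apply/ler_addgt0Pr => e' e'0.
  have [d d0 hd] := phic s0 (introT andP (conj as0 s0b)) e' e'0.
  have [r Sr rs0] := sup_adherent d0 hsS.
  have rle : r <= s0 by exact: ub_le_sup.
  have [/andP[ar rb] hr] := Sr.
  have : `|phi r - phi s0| < e'.
    by apply: hd; rewrite ?ar ?rb// distrC ger0_norm ?subr_ge0// ltrBlDl -ltrBlDr.
  rewrite ltr_norml => /andP[h1 h2].
  have h3 := Wle r s0 ar rle s0b.
  have h4 : e * (r - a) <= e * (s0 - a) by rewrite ler_wpM2l// lerD2r.
  lra.
have [s0lt|] := ltP s0 b; last first.
  by move=> bs0; have <- : s0 = b; [apply/le_anti; rewrite s0b bs0 | case: Ss0].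
have [d d0 hd] := step s0 (introT andP (conj as0 s0lt)).
pose s := Num.min b (s0 + d / 2).
have s0s : s0 < s by rewrite lt_min s0lt/= ltrDl divr_gt0.
have sb : s <= b by rewrite ge_min lexx.
have sd : s < s0 + d.
  by rewrite gt_min; apply/orP; right; rewrite ltrD2l ltr_pdivrMr// ltr_pMr// ltr1n.
have Ss : S s.
  split; first by rewrite sb (le_trans as0 (ltW s0s)).
  have := hd s s0s sd sb; case: Ss0 => _; lra.
have := @ub_le_sup _ S ubS s Ss; rewrite -/s0 => h.
by move: (lt_le_trans s0s h); rewrite ltxx.
Qed.

(** One predicate serves absolute continuity ([G = setT]) and the variation inside an open set [G].
    The increasing order lets a new interval be appended at the end. *)
Definition family_in {K : realType} (G : set K) (a b : K) (k : nat)
    (al be : nat -> K) : Prop :=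
  [/\ forall i, (i < k)%N -> a <= al i /\ al i <= be i /\ be i <= b,
      forall i, (i.+1 < k)%N -> be i <= al i.+1 &
      forall i, (i < k)%N -> `[al i, be i] `<=` G].

Definition abs_cont_on {K : realType} (a b : K) (phi : K -> K) : Prop :=
  forall e : K, 0 < e -> exists2 d : K, 0 < d &
    forall k al be, family_in setT a b k al be ->
      \sum_(i < k) (be i - al i) < d ->
      \sum_(i < k) `|phi (be i) - phi (al i)| < e.

(** Induction from left to right, measuring the part of [G] up to the end of the last interval.
    Closed intervals may share an endpoint, so the half-open []al j, be j]] are measured instead:
    they are disjoint and have the same lengths. *)
Lemma sum_family_in_le {K : realType} (G : set K) (mG : measurable G) a b k al be :
  family_in G a b k al be ->
  ((\sum_(i < k) (be i - al i))%:E <= lebesgue_measure G)%E.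
Proof.
move=> [h1 h2 h3]; case: k h1 h2 h3 => [|k] h1 h2 h3.
  by rewrite big_ord0 measure_ge0.
suff: forall j, (j < k.+1)%N -> ((\sum_(i < j.+1) (be i - al i))%:E <=
    lebesgue_measure (G `&` `]-oo, be j]%classic))%E.
  move=> /(_ k (ltnSn k)) /le_trans; apply.
  by apply: le_measure; rewrite ?inE//; exact: measurableI.
have mI t : measurable (G `&` `]-oo, t]%classic) by exact: measurableI.
have piece j : (j < k.+1)%N ->
    lebesgue_measure (`]al j, be j]%classic : set K) = (be j - al j)%:E.
  move=> /h1[_ [abj _]]; rewrite lebesgue_measure_itv/= lte_fin.
  move: abj; rewrite le_eqVlt => /predU1P[->|->]; last by rewrite EFinB.
  by rewrite ltxx subrr.
have sub j : (j < k.+1)%N -> `]al j, be j]%classic `<=` G `&` `]-oo, be j]%classic.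
  move=> jk t /=; rewrite !in_itv/= => /andP[at_ tb]; split => //.
  by apply: (h3 _ jk); rewrite /= in_itv/= ltW.
elim=> [|j IH] jk.
  rewrite big_ord_recr big_ord0/= add0r -piece//.
  by apply: le_measure; rewrite ?inE//; [exact: mI | exact: sub].
rewrite big_ord_recr/= EFinD -piece//.
have dis : [disjoint G `&` `]-oo, be j]%classic & `]al j.+1, be j.+1]%classic].
  rewrite disj_set2E; apply/eqP/seteqP; split => // t/= [[_]].
  rewrite !in_itv/= => tb /andP[at_ _].
  by have := le_lt_trans (le_trans tb (h2 _ jk)) at_; rewrite ltxx.
apply: (@le_trans _ _ (lebesgue_measure
   ((G `&` `]-oo, be j]%classic) `|` `]al j.+1, be j.+1]%classic))).
  rewrite measureU//; last by apply/eqP; rewrite -disj_set2E.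
  by apply: leeD => //; exact/IH/ltnW.
  exact: mI.
apply: le_measure; rewrite ?inE//.
- by apply: measurableU => //; exact: mI.
- exact: mI.
move=> t [[Gt]|]; last exact: sub.
rewrite /= !in_itv/= => tb; split=> //.
have [_ [abj _]] := h1 _ jk.
by rewrite (le_trans tb)// (le_trans (h2 _ jk)).
Qed.

Lemma ac_nonincreasing {K : realType} (phi : K -> K) (a b : K) : a <= b ->
  abs_cont_on a b phi ->
  {ae @lebesgue_measure K, forall t : K, a <= t < b ->
     right_upper_dini_le phi t 0} ->
  phi b <= phi a.
Proof.
move=> ab ac [E [mE E0 hE]].
have phic t : a <= t <= b -> forall e', 0 < e' -> exists2 d, 0 < d &
     forall s, a <= s <= b -> `|s - t| < d -> `|phi s - phi t| < e'.
  move=> /andP[at_ tb] e' /ac[d d0 hd]; exists d => // s /andP[as_ sb] std.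
  have [st|/ltW ts] := leP s t.
    have := hd 1%N (fun=> s) (fun=> t); rewrite !big_ord1 distrC; apply => //.
    by rewrite -[ltLHS]ger0_norm ?subr_ge0// distrC.
  have := hd 1%N (fun=> t) (fun=> s); rewrite !big_ord1; apply => //.
  by rewrite -[ltLHS]ger0_norm ?subr_ge0.
(* The error has two sources: [e] bounds the variation inside the open cover, [e * (b - a)] is the
   Dini slack outside it. *)
suff main e : 0 < e -> phi b - phi a <= e + e * (b - a).
  rewrite -subr_le0; apply/ler_addgt0Pr => e e0; rewrite add0r.
  have b1 : 0 < 1 + (b - a) by rewrite ltr_wpDr// subr_ge0.
  have := main (e / (1 + (b - a))) (divr_gt0 e0 b1).
  by rewrite -{1}[_ / _]mulr1 -mulrDr divfK// gt_eqF.
move=> e0; have [d d0 hd] := ac e e0.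
have [G [oG EG muG]] : exists G : set K,
    [/\ open G, E `<=` G & (lebesgue_measure G < d%:E)%E].
  have [|G [oG EG muG]] := lebesgue_regularity_outer mE _ d0.
    by rewrite [X in (X < _)%E]E0 ltry.
  exists G; split => //.
  have mG := measurable_realfun.open_measurable oG.
  have -> : G = (G `\` E) `|` E by rewrite setUC setDUK.
  rewrite measureU0//; exact: measurableD.
have mG := measurable_realfun.open_measurable oG.
have famd s k al be : family_in G a s k al be -> \sum_(i < k) (be i - al i) < d.
  by move=> fam; rewrite -lte_fin (le_lt_trans (sum_family_in_le mG fam)).
have famT s k al be : s <= b -> family_in G a s k al be ->
    family_in setT a b k al be.
  move=> sb [h1 h2 h3]; split => // i /h1[? [? ?]]; do 2 split => //.
  exact: le_trans sb.
(* [W s] is the variation of [phi] inside [G] between [a] and [s]. The empty family makes it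
   nonnegative; families inside [G] have total length below [d], so absolute continuity bounds it by
   [e]. *)
pose var k (al be : nat -> K) := \sum_(i < k) `|phi (be i) - phi (al i)|.
pose A s := [set r | exists k al be, family_in G a s k al be /\ r = var k al be].
pose W s := sup (A s).
have A0 s : A s 0.
  by exists 0%N, (fun=> 0), (fun=> 0); split; [split|rewrite /var big_ord0].
have Aub s : s <= b -> ubound (A s) e.
  move=> sb r [k [al [be [fam ->]]]].
  by apply/ltW/hd; [exact: famT fam|exact: famd fam].
have Asup s : s <= b -> has_sup (A s).
  by move=> sb; split; [exists 0|exists e; exact: Aub].
have Wge0 s : s <= b -> 0 <= W s.
  by move=> sb; apply: ub_le_sup => //; exists e; exact: Aub.
have Wle s : s <= b -> W s <= e.
  by move=> sb; apply: ge_sup; [exists 0|exact: Aub].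
have Wmon s t : a <= s -> s <= t -> t <= b -> W s <= W t.
  move=> as_ st tb; apply: le_sup => //; last exact: Asup; last by exists 0.
  move=> r [k [al [be [[h1 h2 h3] ->]]]]; exists (var k al be); split => //.
  exists k, al, be; split => //; split => // i /h1[? [? ?]]; do 2 split => //.
  exact: le_trans st.
have Wadd s t : a <= t -> t <= s -> s <= b -> `[t, s]%classic `<=` G ->
    `|phi s - phi t| <= W s - W t.
  move=> at_ ts sb tsG; rewrite lerBrDr addrC -lerBrDr.
  apply: ge_sup; first by exists 0.
  move=> r [k [al [be [[h1 h2 h3] ->]]]]; rewrite lerBrDr.
  apply: ub_le_sup; first by exists e; exact: Aub.
  (* A family that ends by [t] is extended by [[t, s]], which gets the index [k]. *)
  exists k.+1, (fun i => if i == k then t else al i),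
    (fun i => if i == k then s else be i); split; last first.
    rewrite /var big_ord_recr/= eqxx; congr (_ + _).
    by apply: eq_bigr => i _; rewrite (ltn_eqF (ltn_ord i)).
  split=> i; rewrite ltnS.
  - rewrite leq_eqVlt; case: eqP => [_ _|_ /= /h1[? [? ?]]]; first by [].
    by do 2 split => //; exact: le_trans ts.
  - move=> ik; rewrite (ltn_eqF ik).
    case: eqP => [_|/eqP ne]; first by have [_ []] := h1 i ik.
    by apply: h2; rewrite ltn_neqAle ne.
  - rewrite leq_eqVlt; case: eqP => [_ _|_ /= /h3]; by [].
have step t : a <= t < b -> exists2 d, 0 < d & forall s, t < s -> s < t + d ->
     s <= b -> phi s - phi t <= W s - W t + e * (s - t).
  move=> tab; have /andP[at_ tb] := tab.
  have [Gt|nGt] := pselect (G t).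
    have /nbhs_ballP[r/= r0 hr] := open_nbhs_nbhs (conj oG Gt).
    exists r => // s ts str sb.
    apply: (le_trans (ler_norm _)).
    apply: le_trans (Wadd _ _ at_ (ltW ts) sb _) _.
      move=> z /=; rewrite in_itv/= => /andP[tz zs]; apply: hr.
      rewrite /ball/= distrC ger0_norm ?subr_ge0//.
      by rewrite ltrBlDl (le_lt_trans zs).
    by rewrite lerDl mulr_ge0// ?subr_ge0 ltW.
  have dini : right_upper_dini_le phi t 0.
    by apply: contra_notP nGt => h; apply/EG/hE => /= /(_ tab).
  have [d' d'0 hd'] := dini e e0; exists d' => // s ts std sb.
  apply: le_trans (hd' _ ts std) _; rewrite add0r lerDr subr_ge0.
  by apply: Wmon => //; exact: ltW.
apply: le_trans (real_induction_le ab phic Wmon (ltW e0) step) _.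
by rewrite lerD2r lerBlDr (le_trans (Wle b _))// lerDl; exact: Wge0.
Qed.

(** * The Euclidean norm *)

Definition dot {K : realType} {n : nat} (x y : 'cV[K]_n) : K := (x^T *m y) 0 0.

Section Euclidean.
Context {K : realType}.
Implicit Types m n : nat.

Lemma dotE n (x y : 'cV[K]_n) : dot x y = \sum_i x i 0 * y i 0.
Proof. by rewrite /dot mxE; apply: eq_bigr => i _; rewrite mxE. Qed.

Lemma dotC n (x y : 'cV[K]_n) : dot x y = dot y x.
Proof. by rewrite !dotE; apply: eq_bigr => i _; rewrite mulrC. Qed.

Lemma dotDr n (x y z : 'cV[K]_n) : dot x (y + z) = dot x y + dot x z.
Proof. by rewrite /dot mulmxDr mxE. Qed.

Lemma dotDl n (x y z : 'cV[K]_n) : dot (x + y) z = dot x z + dot y z.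
Proof. by rewrite dotC dotDr !(dotC z). Qed.

Lemma dotZr n a (x y : 'cV[K]_n) : dot x (a *: y) = a * dot x y.
Proof. by rewrite /dot -scalemxAr mxE. Qed.

Lemma dotZl n a (x y : 'cV[K]_n) : dot (a *: x) y = a * dot x y.
Proof. by rewrite dotC dotZr dotC. Qed.

Lemma dot_mulmxl m n (M : 'M[K]_(m, n)) x y : dot (M *m x) y = dot x (M^T *m y).
Proof. by rewrite /dot trmx_mul mulmxA. Qed.

Lemma dotxx n (x : 'cV[K]_n) : dot x x = enorm x ^+ 2.
Proof.
rewrite /enorm sqr_sqrtr ?sumr_ge0// => [|i _]; last exact: sqr_ge0.
by rewrite dotE; apply: eq_bigr => i _; rewrite expr2.
Qed.

Lemma enorm_ge0 n (x : 'cV[K]_n) : 0 <= enorm x.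
Proof. exact: sqrtr_ge0. Qed.

Lemma enorm0 n : enorm (0 : 'cV[K]_n) = 0.
Proof. by rewrite /enorm big1 ?sqrtr0// => i _; rewrite mxE expr0n. Qed.

Lemma enormZ n a (x : 'cV[K]_n) : enorm (a *: x) = `|a| * enorm x.
Proof.
apply/eqP; rewrite -(eqrXn2 (_ : 0 < 2)%N)// ?mulr_ge0 ?enorm_ge0//.
by rewrite exprMn real_normK ?num_real// -!dotxx dotZl dotZr mulrA expr2.
Qed.

Lemma enormN n (x : 'cV[K]_n) : enorm (- x) = enorm x.
Proof. by rewrite -scaleN1r enormZ normrN1 mul1r. Qed.

Lemma entry_le_enorm n (x : 'cV[K]_n) i : `|x i 0| <= enorm x.
Proof.
rewrite -sqrtr_sqr ler_sqrt; last by apply: sumr_ge0 => j _; exact: sqr_ge0.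
by rewrite (bigD1 i)//= lerDl sumr_ge0// => j _; exact: sqr_ge0.
Qed.

Lemma enorm_eq0 n (x : 'cV[K]_n) : enorm x = 0 -> x = 0.
Proof.
move=> x0; apply/colP => i; rewrite mxE; apply/eqP.
by rewrite -normr_le0 (le_trans (entry_le_enorm x i))// x0.
Qed.

(** Expand the square of the norm of [enorm y *: x - enorm x *: y] and divide by
    [2 * (enorm x * enorm y)]. *)
Lemma cauchy_schwarz n (x y : 'cV[K]_n) : dot x y <= enorm x * enorm y.
Proof.
have [/enorm_eq0 ->|x0] := eqVneq (enorm x) 0.
  by rewrite enorm0 mul0r /dot trmx0 mul0mx mxE.
have [/enorm_eq0 ->|y0] := eqVneq (enorm y) 0.
  by rewrite enorm0 mulr0 /dot mulmx0 mxE.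
have xp : 0 < enorm x by rewrite lt_def x0 enorm_ge0.
have yp : 0 < enorm y by rewrite lt_def y0 enorm_ge0.
have : 0 <= dot (enorm y *: x - enorm x *: y) (enorm y *: x - enorm x *: y).
  by rewrite dotxx sqr_ge0.
rewrite -scaleNr !(dotDl, dotDr, dotZl, dotZr) !dotxx (dotC y x) => h.
have : 0 <= (2 * (enorm x * enorm y)) * (enorm x * enorm y - dot x y) by lra.
by rewrite pmulr_rge0 ?subr_ge0// !mulr_gt0.
Qed.

Lemma enormD n (x y : 'cV[K]_n) : enorm (x + y) <= enorm x + enorm y.
Proof.
rewrite -(ler_pXn2r (_ : 0 < 2)%N)// ?nnegrE ?addr_ge0 ?enorm_ge0//.
rewrite -dotxx dotDl !dotDr !dotxx (dotC y x).
have := cauchy_schwarz x y; lra.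
Qed.

Lemma enormB n (x y : 'cV[K]_n) : enorm (x - y) <= enorm x + enorm y.
Proof. by rewrite -(enormN y); exact: enormD. Qed.

Lemma enorm_distC n (x y : 'cV[K]_n) : enorm (x - y) = enorm (y - x).
Proof. by rewrite -opprB enormN. Qed.

Lemma ler_enorm_dist n (x y : 'cV[K]_n) : `|enorm x - enorm y| <= enorm (x - y).
Proof.
rewrite ler_norml; have := enormD (x - y) y; have := enormD (y - x) x.
rewrite !subrK (enorm_distC y x); lra.
Qed.

Lemma norm_le_enorm n (x : 'cV[K]_n) : `|x| <= enorm x.
Proof.
rewrite [leLHS]mx_normrE; apply/bigmax_leP; split; first exact: enorm_ge0.
by move=> [i j] _ /=; rewrite ord1; exact: entry_le_enorm.
Qed.

Lemma enorm_le_norm n (x : 'cV[K]_n) : enorm x <= n%:R * `|x|.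
Proof.
have entry i : `|x i 0| <= `|x|.
  rewrite [leRHS]mx_normrE.
  exact: (le_bigmax _ (fun ij : 'I_n * 'I_1 => `|x ij.1 ij.2|) (i, 0)).
rewrite -(ler_pXn2r (_ : 0 < 2)%N)// ?nnegrE ?mulr_ge0 ?enorm_ge0 ?ler0n//.
rewrite -dotxx dotE (@le_trans _ _ (\sum_(i < n) `|x| ^+ 2))//.
  by apply: ler_sum => i _; rewrite -expr2 -real_normK ?num_real// lerXn2r ?nnegrE.
rewrite sumr_const card_ord exprMn -[leLHS]mulr_natl ler_wpM2r ?sqr_ge0//.
rewrite -natrX ler_nat.
by case: (n) => // k; rewrite expnS leq_pmulr// expn1.
Qed.

(** This bounds the sets in [op_snorm] and [op_norm_to_snorm], so that their [sup] is a genuine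
    upper bound and not a default value. *)
Lemma enorm_mulmx_bounded m n (M : 'M[K]_(m, n)) :
  exists2 C, 0 <= C & forall w, enorm (M *m w) <= C * enorm w.
Proof.
exists (m%:R * \sum_i \sum_j `|M i j|).
  by rewrite mulr_ge0 ?ler0n// sumr_ge0// => i _; exact: sumr_ge0.
move=> w; apply: le_trans (enorm_le_norm _) _.
rewrite -mulrA ler_wpM2l ?ler0n// [leLHS]mx_normrE.
apply/bigmax_leP; split=> [|[i j] _ /=].
  by rewrite mulr_ge0 ?enorm_ge0 ?sumr_ge0// => i _; exact: sumr_ge0.
rewrite ord1 mxE (le_trans (ler_norm_sum _ _ _))// mulr_suml (bigD1 i)//=.
rewrite -[leLHS]addr0 lerD//.
  rewrite mulr_suml; apply: ler_sum => k _.
  by rewrite normrM ler_wpM2l ?entry_le_enorm.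
apply: sumr_ge0 => k _; rewrite mulr_ge0 ?enorm_ge0//; exact: sumr_ge0.
Qed.

Lemma enorm_tr_isometry m n (S : 'M[K]_(m, n)) (xi : 'cV[K]_m) :
  S *m S^T = 1%:M -> enorm (S^T *m xi) = enorm xi.
Proof.
move=> SS; apply/eqP; rewrite -(eqrXn2 (_ : 0 < 2)%N)// ?enorm_ge0//.
by rewrite -!dotxx dot_mulmxl trmxK mulmxA SS mul1mx.
Qed.

Lemma ker_distE m n (S : 'M[K]_(m, n)) x y :
  ker_dist S x y = enorm (S *m (x - y)).
Proof.
rewrite /ker_dist -[RHS]inf1; congr inf; apply/seteqP; split => [r [v Sv <-]|r ->] /=.
  by rewrite /snorm opprD addrA mulmxBr Sv subr0.
by exists 0; rewrite /kerset/= ?mulmx0// addr0.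
Qed.

End Euclidean.

(** * First-order expansions in the Euclidean norm *)

Section Differentiation.
Context {K : realType}.
Implicit Types m n p : nat.

(** The underlying limit is in the sup norm: [e / n.+1%:R] pays for the factor [n] of
    [enorm_le_norm], and [n.+1] keeps the divisor positive when [n = 0]. *)
Lemma derivable_enorm n (x : K -> 'cV[K]_n) t : derivable x t 1 ->
  forall e, 0 < e -> exists2 d, 0 < d & forall s, t < s -> s < t + d ->
    enorm (x s - x t - (s - t) *: 'D_1 x t) <= e * (s - t).
Proof.
move=> dx e e0; have n1 : 0 < n.+1%:R :> K by rewrite ltr0n.
have : h^-1 *: ((x \o shift t) (h *: 1) - x t) @[h --> 0^'] --> 'D_1 x t by exact: dx.
move=> /cvgrPdist_le /(_ (e / n.+1%:R) (divr_gt0 e0 n1)).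
rewrite /dnbhs near_withinE => /nbhs_ballP[d /= d0 hd]; exists d => // s ts std.
have st0 : 0 < s - t by rewrite subr_gt0.
have := hd (s - t); rewrite /ball/= sub0r normrN gtr0_norm// ltrBlDl.
move=> /(_ std (lt0r_neq0 st0)) h.
have {h} h : enorm ((s - t)^-1 *: (x s - x t) - 'D_1 x t) <= e.
  apply: le_trans (enorm_le_norm _) _; rewrite distrC.
  move: h; rewrite /GRing.scale/= mulr1 subrK => h.
  apply: (@le_trans _ _ (n%:R * (e / n.+1%:R))); first by rewrite ler_wpM2l.
  by rewrite mulrCA ler_piMr// ?(ltW e0)// ler_pdivrMr// mul1r ler_nat.
have -> : x s - x t - (s - t) *: 'D_1 x t =
    (s - t) *: ((s - t)^-1 *: (x s - x t) - 'D_1 x t).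
  by rewrite scalerBr scalerA divff ?scale1r// gt_eqF.
by rewrite enormZ gtr0_norm// mulrC ler_wpM2r// ltW.
Qed.

Lemma derive_jac n p (g : 'cV[K]_p -> 'cV[K]_n) w k : differentiable g w ->
  'D_k g w = jac g w *m k.
Proof.
move=> dg; rewrite deriveE//.
have {1}-> : k = \sum_(j < p) k j 0 *: delta_mx j 0.
  by rewrite {1}[k]matrix_sum_delta; apply: eq_bigr => j _; rewrite big_ord1.
rewrite linear_sum; apply/colP => i; rewrite summxE mxE.
by apply: eq_bigr => j _; rewrite linearZ/= !mxE deriveE// mulrC.
Qed.

Lemma differentiable_enorm n p (g : 'cV[K]_p -> 'cV[K]_n) w : differentiable g w ->
  forall e, 0 < e -> exists2 d, 0 < d & forall k, enorm k < d ->
    enorm (g (w + k) - g w - jac g w *m k) <= e * enorm k.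
Proof.
move=> dg e e0; have n1 : 0 < n.+1%:R :> K by rewrite ltr0n.
have /eqaddoP /(_ _ (divr_gt0 e0 n1)) := diff_locally dg.
move=> /nbhs_ballP[d /= d0 hd]; exists d => // k kd.
set o := g (w + k) - g w - jac g w *m k.
have {}hd : `|o| <= e / n.+1%:R * `|k|.
  have := hd k; rewrite -ball_normE/= sub0r normrN.
  move=> /(_ (le_lt_trans (norm_le_enorm k) kd)).
  by rewrite !fctE/= -deriveE// derive_jac// opprD addrA (addrC k).
apply: le_trans (enorm_le_norm _) _.
apply: (@le_trans _ _ (n%:R * (e / n.+1%:R * enorm k))).
  rewrite ler_wpM2l// (le_trans hd)// ler_wpM2l ?norm_le_enorm//.
  by rewrite divr_ge0// ltW.
rewrite mulrA ler_wpM2r ?enorm_ge0//.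
by rewrite mulrCA ler_piMr// ?(ltW e0)// ler_pdivrMr// mul1r ler_nat.
Qed.

Lemma dot_continuous n (eta : 'cV[K]_n) : continuous (dot eta).
Proof.
have dot_le y : `|dot eta y| <= enorm eta * enorm y.
  rewrite ler_norml cauchy_schwarz andbT -[X in _ <= X]opprK lerN2.
  by rewrite -mulN1r -dotZr scaleN1r -(enormN y); exact: cauchy_schwarz.
move=> y; apply/(@cvgrPdist_le _ _ _ (nbhs y)) => e e0; set C := enorm eta * n%:R.
have C1 : 0 < C + 1 by rewrite ltr_wpDl// mulr_ge0// enorm_ge0.
apply/nbhs_ballP; exists (e / (C + 1)); first exact: divr_gt0.
move=> z /=; rewrite -ball_normE/= => yz.
rewrite -[X in _ - X]mul1r -mulNr -dotZr scaleN1r -dotDr.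
apply: le_trans (dot_le _) _.
apply: (@le_trans _ _ (C * `|y - z|)).
  by rewrite -mulrA ler_wpM2l ?enorm_ge0 ?enorm_le_norm.
apply: (@le_trans _ _ ((C + 1) * `|y - z|)); first by rewrite ler_wpM2r// lerDl.
by rewrite mulrC -ler_pdivlMr// ltW.
Qed.

(** The difference quotient of the scalar function is [dot eta] of the quotient of [F] in direction
    [v], so linearity and continuity of [dot eta] carry the limit over. *)
Lemma is_derive_dot_segment n p (F : 'cV[K]_p -> 'cV[K]_n) (eta : 'cV[K]_n) q v
    (s : K) : differentiable F (q + s *: v) ->
  is_derive s (1 : K) (fun r : K => dot eta (F (q + r *: v)))
    (dot eta (jac F (q + s *: v) *m v)).
Proof.
move=> dF; set G := fun r : K => _.
suff cv : h^-1 *: ((G \o shift s) (h *: (1 : K)) - G s) @[h --> 0^'] -->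
    dot eta (jac F (q + s *: v) *m v).
  by split; [apply/cvg_ex; eexists; exact: cv | exact: cvg_lim].
have : h^-1 *: ((F \o shift (q + s *: v)) (h *: v) - F (q + s *: v)) @[h --> 0^']
    --> 'D_v F (q + s *: v) by apply: diff_derivable.
rewrite derive_jac// => /(continuous_cvg _ (@dot_continuous _ eta _)).
apply: cvg_trans; apply: near_eq_cvg; near=> h.
have h1 : h *: (1 : K) = h by exact: mulr1.
rewrite /G /= dotZr dotDr -scaleN1r dotZr mulN1r h1.
by rewrite (scalerDl v h s) addrCA.
Unshelve. all: by end_near. Qed.
End Differentiation.

(** * Semi-contraction *)

Section SemiContraction.
Context {K : realType} {m n : nat} (S : 'M[K]_(m, n)).
Hypothesis SS : S *m S^T = 1%:M.

(** [S^T *m S] is the orthogonal projector onto the complement of [ker S]. The residue [r] lies in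
    [ker S], hence is orthogonal both to [z] and to the range of [S^T], hence to itself. *)
Lemma tr_mul_of_ker_perp (z : 'cV[K]_n) :
  (forall v, kerset S v -> z^T *m v = 0) -> S^T *m (S *m z) = z.
Proof.
move=> zperp; set r := z - S^T *m (S *m z).
have Sr : S *m r = 0 by rewrite mulmxBr (mulmxA S) SS mul1mx subrr.
suff : r = 0 by move/eqP; rewrite subr_eq0 => /eqP.
apply: enorm_eq0; apply/eqP; rewrite -sqrf_eq0 -dotxx {1}/r.
rewrite -scaleN1r dotDl dotZl dot_mulmxl trmxK Sr.
by rewrite {1}/dot zperp// /dot mulmx0 !mxE mulr0 addr0.
Qed.

(** The vectors [S^T *m xi] with [xi] of norm 1 are admissible in the supremum. Conversely every
    admissible [z] equals [S^T *m (S *m z)] and so has Euclidean norm 1, which bounds the set. *)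
Lemma enorm_le_op_snorm A (xi : 'cV[K]_m) : enorm xi = 1 ->
  enorm (S *m (A *m (S^T *m xi))) <= op_snorm S A.
Proof.
move=> xi1; apply: ub_le_sup.
  have [C C0 hC] := enorm_mulmx_bounded (S *m A).
  exists C => _ [z [zperp Sz1] <-]; rewrite /snorm mulmxA.
  apply: le_trans (hC _) _; rewrite -(tr_mul_of_ker_perp zperp).
  by rewrite enorm_tr_isometry// (_ : enorm _ = 1)// mulr1.
exists (S^T *m xi) => //; split=> [v Sv|].
  by rewrite trmx_mul trmxK -mulmxA Sv mulmx0.
by rewrite /snorm mulmxA SS mul1mx.
Qed.

(** For a unit vector [eta], Cauchy-Schwarz gives [1 + h * dot eta (S *m (A *m (S^T *m eta))) <=
    op_snorm S (1%:M + h *: A)], so each difference quotient with [h > 0] dominates the quadratic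
    form; so does their limit. Homogeneity gives the other vectors. *)
Lemma dot_le_log_snorm A (c : K) (xi : 'cV[K]_m) : 0 < c -> log_snorm S A <= - c ->
  dot xi (S *m (A *m (S^T *m xi))) <= - c * enorm xi ^+ 2.
Proof.
move=> c0 hA.
have unit eta : enorm eta = 1 -> dot eta (S *m (A *m (S^T *m eta))) <= - c.
  move=> eta1; apply: le_trans (hA); rewrite /log_snorm.
  set q := fun h : K => _.
  have [cq|/dvgP q0] := pselect (cvg (q @ 0^'+)); last first.
    (* a divergent lim has the junk value 0, which is not <= - c *)
    by move: hA; rewrite /log_snorm -/q q0 oppr_ge0 leNgt c0.
  apply: limr_ge => //; near=> h.
  have h0 : 0 < h by near: h; exact: nbhs_right_gt.
  rewrite /q ler_pdivlMr// lerBrDl mulrC.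
  have := enorm_le_op_snorm (1%:M + h *: A) eta1; apply: le_trans.
  have := cauchy_schwarz eta (S *m ((1%:M + h *: A) *m (S^T *m eta))).
  rewrite eta1 mul1r; apply: le_trans.
  rewrite mulmxDl mul1mx mulmxDr (mulmxA S S^T) SS mul1mx -scalemxAl -scalemxAr.
  by rewrite dotDr dotZr dotxx eta1 expr1n.
have [/enorm_eq0 ->|xi0] := eqVneq (enorm xi) 0.
  by rewrite /dot trmx0 mul0mx mxE enorm0 expr0n mulr0.
have xip : 0 < enorm xi by rewrite lt_def xi0 enorm_ge0.
have := unit ((enorm xi)^-1 *: xi).
rewrite enormZ gtr0_norm ?invr_gt0// mulVf// => /(_ erefl).
rewrite -!scalemxAr dotZl dotZr mulrA -invfM -expr2.
by rewrite mulrC ler_pdivrMr ?exprn_gt0.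
Unshelve. all: by end_near. Qed.

Variables (p : nat) (f : 'cV[K]_n -> 'cV[K]_p -> 'cV[K]_n) (u : K -> 'cV[K]_p).
Variables (D : set 'cV[K]_n) (c t : K).
Hypotheses (c0 : 0 < c) (convD : convex_set D) (t0 : 0 <= t).
Hypotheses (df : forall y, differentiable (f ^~ (u t)) y).
Hypotheses (contr : semi_contracting S f u D c) (pker : preserves_kernel S f u D).

Lemma segment_in y z s : D y -> D z -> 0 <= s <= 1 -> D (y + s *: (z - y)).
Proof.
move=> Dy Dz /andP[s0 s1].
have := convD (Itv01 s0 s1) (mem_set Dz) (mem_set Dy); rewrite inE.
have <- : s *: z + (1 - s) *: y = y + s *: (z - y).
  by rewrite scalerBl scale1r scalerBr addrCA addrA.
exact.
Qed.

(** The mean value equality fails for vector-valued maps, so it is applied to the component along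
    [eta]; the point [w] depends on [eta]. *)
Lemma dot_mvt eta y z : D y -> D z -> exists2 w, D w &
  dot eta (S *m (f z (u t) - f y (u t))) =
  dot eta (S *m (jac (f ^~ (u t)) w *m (z - y))).
Proof.
move=> Dy Dz; set F := f ^~ (u t).
pose G (r : K) := dot (S^T *m eta) (F (y + r *: (z - y))).
have dG r : is_derive r (1 : K) G
    (dot (S^T *m eta) (jac F (y + r *: (z - y)) *m (z - y))).
  exact: is_derive_dot_segment.
have cG : {within `[0, 1], continuous G}.
  apply: derivable_within_continuous => r _.
  exact: (@ex_derive _ _ _ _ _ _ _ (dG r)).
have [r /[!in_itv]/= /andP[/ltW r0 /ltW r1]] := MVT ltr01 (fun r _ => dG r) cG.
rewrite subr0 mulr1 /G scale1r scale0r addr0 subrKC => h.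
exists (y + r *: (z - y)); first by apply: segment_in => //; rewrite r0.
move: h; rewrite !dot_mulmxl trmxK => <-.
by rewrite mulmxBr -scaleN1r dotDr dotZr mulN1r.
Qed.

Lemma semi_contracting_dot y z : D y -> D z ->
  dot (S *m (z - y)) (S *m (f z (u t) - f y (u t)))
    <= - c * enorm (S *m (z - y)) ^+ 2.
Proof.
move=> Dy Dz; have [w Dw ->] := dot_mvt (S *m (z - y)) Dy Dz.
apply: le_trans (dot_le_log_snorm (S *m (z - y)) c0 (contr Dw t0)).
set v := z - y; set J := jac _ w.
have kr : kerset S (v - S^T *m (S *m v)).
  by rewrite /kerset/= mulmxBr (mulmxA S) SS mul1mx subrr.
have := pker Dw t0 kr; rewrite /kerset/= mulmxBr mulmxBr => /eqP.
by rewrite subr_eq0 => /eqP ->.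
Qed.

(** This covers a vanishing tracking error, where the norm is not differentiable and
    [semi_contracting_dot] says nothing. The mean value equality is tested against [d] itself. *)
Lemma semi_contracting_ker y z : D y -> D z -> S *m (z - y) = 0 ->
  S *m (f z (u t) - f y (u t)) = 0.
Proof.
move=> Dy Dz Szy; set d := S *m _.
apply: enorm_eq0; apply/eqP; rewrite -sqrf_eq0 -dotxx; apply/eqP.
have [w Dw ->] := dot_mvt d Dy Dz.
by rewrite (pker Dw t0 Szy) /dot mulmx0 mxE.
Qed.

End SemiContraction.

(** * The tracking error *)

Section Tracking.
Context {K : realType}.
Implicit Types m n p : nat.

Lemma enorm_le_op_norm_to_snorm m n p (S : 'M[K]_(m, n)) (M : 'M[K]_(n, p)) w :
  enorm (S *m (M *m w)) <= op_norm_to_snorm S M * enorm w.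
Proof.
have [/enorm_eq0 ->|w0] := eqVneq (enorm w) 0.
  by rewrite !mulmx0 !enorm0 mulr0.
have wp : 0 < enorm w by rewrite lt_def w0 enorm_ge0.
rewrite -ler_pdivrMr//.
have -> : enorm (S *m (M *m w)) / enorm w = snorm S (M *m ((enorm w)^-1 *: w)).
  by rewrite /snorm -!scalemxAr enormZ gtr0_norm ?invr_gt0// mulrC.
apply: ub_le_sup.
  have [C C0 hC] := enorm_mulmx_bounded (S *m M).
  exists C => _ [v v1 <-]; rewrite /snorm mulmxA.
  by apply: le_trans (hC _) _; rewrite v1 mulr1.
exists ((enorm w)^-1 *: w) => //=.
by rewrite enormZ gtr0_norm ?invr_gt0// mulVf.
Qed.

(** Absolute continuity passes to any function whose increments are dominated by those of [g] plus a
    Lipschitz term. Each term gets half of [e]; the divisors [C + 1] and [L + 1] stay positive when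
    [C] or [L] vanishes. *)
Lemma abs_cont_on_dominated n (g : K -> 'cV[K]_n) (phi : K -> K) a b C L :
  loc_abs_cont g -> 0 <= a -> 0 <= C -> 0 <= L ->
  (forall s t, a <= s -> s <= t -> t <= b ->
     `|phi t - phi s| <= C * enorm (g t - g s) + L * (t - s)) ->
  abs_cont_on a b phi.
Proof.
move=> gac a0 C0 L0 hphi e e0.
have C1 : 0 < C + 1 by lra.
have L1 : 0 < L + 1 by lra.
have e2 : 0 < e / 2 by rewrite divr_gt0.
have [d d0 hd] := gac b _ (divr_gt0 e2 C1).
exists (Num.min d (e / 2 / (L + 1))) => [|k al be [h1 h2 _]].
  by rewrite lt_min d0 divr_gt0.
rewrite lt_min => /andP[sd sL].
have := hd k al be _ h2 sd.
have h1' i : (i < k)%N -> 0 <= al i /\ al i <= be i /\ be i <= b.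
  by move=> /h1[? ?]; split=> //; exact: le_trans a0 _.
move=> /(_ h1') sC.
move: sC sL; rewrite !ltr_pdivlMr//.
set A := \sum_(i < k) _; set B := \sum_(i < k) _ => sC sL.
have A0 : 0 <= A by apply: sumr_ge0 => i _; exact: enorm_ge0.
have B0 : 0 <= B.
  by apply: sumr_ge0 => i _; rewrite subr_ge0; have [_ []] := h1 i (ltn_ord i).
apply: (@le_lt_trans _ _ (C * A + L * B)); last lra.
rewrite !mulr_sumr -big_split/=; apply: ler_sum => i _.
by have [? [? ?]] := h1 i (ltn_ord i); exact: hphi.
Qed.

Lemma ae_imply (P Q : K -> Prop) : (forall t, P t -> Q t) ->
  {ae @lebesgue_measure K, forall t, P t} -> {ae @lebesgue_measure K, forall t, Q t}.
Proof.
by move=> PQ [E [mE E0 sub]]; exists E; split => // t nQ; apply: sub => /PQ.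
Qed.

(** For fixed [a], the function [enorm (u s - u a) - eps * s] has nonpositive Dini derivative almost
    everywhere, so [ac_nonincreasing] replaces integration of the derivative. *)
Lemma lipschitz_of_ae_derive_le n (u : K -> 'cV[K]_n) eps : loc_abs_cont u ->
  {ae @lebesgue_measure K, forall t : K, 0 <= t ->
     derivable u t 1 /\ enorm ('D_1 u t) <= eps} ->
  forall a b, 0 <= a -> a <= b -> enorm (u b - u a) <= eps * (b - a).
Proof.
move=> uac hu a b a0 ab.
suff : enorm (u b - u a) - eps * b <= enorm (u a - u a) - eps * a.
  by rewrite subrr enorm0; lra.
apply: (@ac_nonincreasing K (fun s => enorm (u s - u a) - eps * s)) => //.
  apply: (@abs_cont_on_dominated n u _ a b 1 `|eps|) => // s t as_ st tb.
  have -> : enorm (u t - u a) - eps * t - (enorm (u s - u a) - eps * s) =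
    (enorm (u t - u a) - enorm (u s - u a)) - eps * (t - s) by ring.
  apply: le_trans (ler_normB _ _) _; rewrite mul1r normrM.
  rewrite [`|t - s|]ger0_norm ?subr_ge0// lerD2r.
  by apply: le_trans (ler_enorm_dist _ _) _; rewrite opprB addrA subrK.
apply: ae_imply hu => t ht /andP[at_ _].
have [du le] := ht (le_trans a0 at_).
move=> e e0; have [d d0 hd] := derivable_enorm du e0.
exists d => // s ts std; have := hd s ts std.
have st0 : 0 < s - t by rewrite subr_gt0.
have h1 : enorm (u s - u t) <= enorm (u s - u t - (s - t) *: 'D_1 u t) +
    (s - t) * enorm ('D_1 u t).
  have := enormD (u s - u t - (s - t) *: 'D_1 u t) ((s - t) *: 'D_1 u t).
  by rewrite subrK enormZ (gtr0_norm st0).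
have h2 := enormD (u s - u t) (u t - u a); rewrite addrA subrK in h2.
have h3 : (s - t) * enorm ('D_1 u t) <= (s - t) * eps by rewrite ler_wpM2l// ltW.
lra.
Qed.

(** Away from [xi = 0] both sides are squared: the inner product yields the decay, and
    [h ^+ 2 * Z ^+ 2] is the remainder to absorb. At [xi = 0] the vector [zeta] vanishes too. *)
Lemma enorm_add_scale_le m (xi zeta : 'cV[K]_m) c : 0 < c ->
  dot xi zeta <= - c * enorm xi ^+ 2 -> (xi = 0 -> zeta = 0) ->
  forall e, 0 < e -> exists2 d, 0 < d & forall h, 0 < h -> h < d ->
    enorm (xi + h *: zeta) <= enorm xi + (- c * enorm xi + e) * h.
Proof.
move=> c0 hdot hz e e0.
have [/enorm_eq0 xi0|xi0] := eqVneq (enorm xi) 0.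
  exists 1 => // h h0 _; rewrite (hz xi0) scaler0 addr0 xi0 enorm0.
  by rewrite mulr0 !add0r mulr_ge0// ltW.
have xip : 0 < enorm xi by rewrite lt_def xi0 enorm_ge0.
set N := enorm xi in hdot xip *; set Z := enorm zeta.
have Z1 : 0 < Z ^+ 2 + 1 by rewrite ltr_wpDl// sqr_ge0.
(* The first bound keeps the right-hand side nonnegative, so that squaring is legitimate; the second
   gives [h * Z ^+ 2 <= N * e]. *)
exists (Num.min ((2 * c)^-1) (N * e / (Z ^+ 2 + 1))) => [|h h0].
  by rewrite lt_min invr_gt0 mulr_gt0//= divr_gt0// mulr_gt0.
rewrite lt_min -[(2 * c)^-1]mul1r !ltr_pdivlMr ?mulr_gt0// => /andP[h1 h2].
have cN : c * h * N < N / 2 by rewrite mulrC ltr_pM2l//; lra.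
have eh : 0 < e * h by rewrite mulr_gt0.
have rhs0 : 0 <= N + (- c * N + e) * h by lra.
rewrite -(ler_pXn2r (_ : 0 < 2)%N) ?nnegrE ?enorm_ge0//.
rewrite -dotxx dotDl !dotDr !dotZl !dotZr !dotxx (dotC zeta) -/N -/Z.
have k1 : h * dot xi zeta <= h * (- c * N ^+ 2) by rewrite ler_wpM2l// ltW.
have k2 : h * (h * Z ^+ 2) <= h * (N * e).
  by rewrite ler_wpM2l ?(ltW h0)//; nra.
have k3 : 0 <= (e * h) * (N - 2 * (c * h * N)) by rewrite mulr_ge0; lra.
have k4 : 0 <= (c * h * N - e * h) ^+ 2 by rewrite sqr_ge0.
have -> : (N + (- c * N + e) * h) ^+ 2 =
  N ^+ 2 - 2 * (h * (c * N ^+ 2)) + 2 * (e * h * N) + (c * h * N - e * h) ^+ 2 by ring.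
have := mulr_ge0 (ltW eh) (ltW xip); lra.
Qed.

(** * Exponential decay from a Dini inequality *)

Lemma expRB_le (c s t T : K) : 0 < c -> s <= t -> t <= T ->
  `|expR (c * t) - expR (c * s)| <= c * expR (c * T) * (t - s).
Proof.
move=> c0 st tT.
have ets : expR (c * s) = expR (c * t) * expR (- (c * (t - s))).
  by rewrite -expRD; congr expR; ring.
rewrite ger0_norm; last by rewrite subr_ge0 ler_expR ler_pM2l.
have := expR_ge1Dx (- (c * (t - s))).
have le1 : expR (c * t) <= expR (c * T) by rewrite ler_expR ler_pM2l.
have st0 : 0 <= c * (t - s) by rewrite mulr_ge0 ?subr_ge0// ltW.
have := expR_gt0 (c * t); rewrite ets.
set a := expR (c * t) in le1 *; set b := expR (- _); set M := expR (c * T) in le1 *.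
move=> a0 hb; apply: (@le_trans _ _ (a * (c * (t - s)))).
  by rewrite -[X in X - _]mulr1 -mulrBr ler_wpM2l ?(ltW a0)//; lra.
by rewrite mulrA (mulrC a) ler_wpM2r ?subr_ge0// ler_wpM2l// ltW.
Qed.

(** With [W = V t - l / c] the hypothesis bounds the Dini derivative of [V] by [- c * W], which the
    derivative of the integrating factor cancels to first order. A remainder of order
    [c ^+ 2 * |W| * h ^+ 2] is left. *)
Lemma dini_le_decay (V : K -> K) c l t : 0 < c ->
  right_upper_dini_le V t (- c * V t + l) ->
  right_upper_dini_le (fun s => expR (c * s) * (V s - l / c)) t 0.
Proof.
move=> c0 hV e e0.
set M := expR (c * (t + 1)); have M0 : 0 < M by exact: expR_gt0.
have M2 : 0 < 2 * M by rewrite mulr_gt0.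
have [d d0 hd] := hV _ (divr_gt0 e0 M2).
set W := V t - l / c; set Q := 2 * M * (c ^+ 2 * `|W| + 1).
have Q0 : 0 < Q by rewrite mulr_gt0// ltr_wpDl// mulr_ge0// sqr_ge0.
(* The cap 1 gives [expR (c * s) <= M]. The slack [e / (2 * M)] and the bound [h < e / Q] each cost
   at most [e / 2 * h] after multiplication by [M]. *)
exists (Num.min (Num.min d 1) (e / Q)) => [|s ts].
  by rewrite !lt_min d0 ltr01 divr_gt0.
rewrite -ltrBlDl !lt_min => /andP[/andP[hd1 h1] hQ].
have hs := hd s ts; rewrite -ltrBlDl in hs; have {hs hd} hs := hs hd1.
set h := s - t in hs hd1 h1 hQ *; have h0 : 0 < h by rewrite subr_gt0.
have cW : - c * V t + l = - c * W.
  by rewrite /W mulrBr !mulNr opprK mulrCA divff ?mulr1// gt_eqF.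
rewrite cW in hs.
have et : expR (c * t) = expR (c * s) * expR (- (c * h)).
  by rewrite -expRD /h; congr expR; ring.
have sM : expR (c * s) <= M.
  by rewrite ler_expR ler_pM2l// -lerBlDl ltW.
rewrite et add0r; set E := expR (c * s) in sM *.
have E0 : 0 < E by exact: expR_gt0.
set b := expR (- (c * h)).
have y0 : 0 < c * h by rewrite mulr_gt0.
have b1 : 1 - c * h <= b by have := expR_ge1Dx (- (c * h)); rewrite -/b.
have b2 : b * (1 + c * h) <= 1.
  by rewrite /b expRN mulrC ler_pdivrMr ?expR_gt0// mul1r expR_ge1Dx.
(* [b2] bounds the left side by [c * h * (1 - b)], and [b1] gives [1 - b <= c * h]. *)
have b3 : b - 1 + c * h <= (c * h) ^+ 2 by nra.
have : (1 - c * h - b) * W <= (c * h) ^+ 2 * `|W|.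
  apply: le_trans (ler_norm _) _; rewrite normrM ler_wpM2r//.
  by rewrite ler0_norm; lra.
move=> hW.
have k1 : V s - l / c - b * W <= c ^+ 2 * `|W| * h ^+ 2 + e / (2 * M) * h.
  have -> : V s - l / c = V s - V t + W by rewrite /W; ring.
  move: hW; rewrite exprMn; lra.
have k2 : e / (2 * M) * h * M = e / 2 * h by field; rewrite gt_eqF.
have k3 : c ^+ 2 * `|W| * h ^+ 2 * M <= e / 2 * h.
  move: hQ; rewrite ltr_pdivlMr// /Q => hQ.
  have := mulr_gt0 M0 h0; have := ler_wpM2l (ltW h0) (ltW hQ); nra.
have k4 : 0 <= c ^+ 2 * `|W| * h ^+ 2 + e / (2 * M) * h.
  by rewrite addr_ge0// mulr_ge0 ?divr_ge0 ?mulr_ge0 ?sqr_ge0// ltW.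
have -> : E * (V s - l / c) - E * b * W = E * (V s - l / c - b * W) by ring.
apply: (@le_trans _ _ (E * (c ^+ 2 * `|W| * h ^+ 2 + e / (2 * M) * h))).
  by rewrite ler_wpM2l// ltW.
apply: (@le_trans _ _ (M * (c ^+ 2 * `|W| * h ^+ 2 + e / (2 * M) * h))).
  by rewrite ler_wpM2r.
lra.
Qed.

Lemma ac_gronwall n (g : K -> 'cV[K]_n) (V : K -> K) (c l C L T : K) :
  0 < c -> 0 <= l -> 0 <= T -> 0 <= C -> 0 <= L -> loc_abs_cont g ->
  (forall t, 0 <= V t) ->
  (forall s t, 0 <= s -> s <= t -> t <= T ->
     `|V t - V s| <= C * enorm (g t - g s) + L * (t - s)) ->
  {ae @lebesgue_measure K, forall t : K, 0 <= t ->
     right_upper_dini_le V t (- c * V t + l)} ->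
  V T <= expR (- c * T) * V 0 + l / c * (1 - expR (- c * T)).
Proof.
move=> c0 l0 T0 C0 L0 gac V0 hV dini.
(* An a priori bound, from dropping [- c * V t <= 0]. It is what makes the product [phi] below
   absolutely continuous. *)
have Vbd t : 0 <= t -> t <= T -> V t <= V 0 + l * t.
  move=> t0 tT; rewrite -lerBlDr -[leRHS]subr0 -[X in _ <= _ - X](mulr0 l).
  apply: (@ac_nonincreasing K (fun s => V s - l * s)) => //.
    apply: (@abs_cont_on_dominated n g _ 0 t C (L + l)) => // [|r s r0 rs st].
      by rewrite addr_ge0.
    have -> : V s - l * s - (V r - l * r) = (V s - V r) - l * (s - r) by ring.
    apply: le_trans (ler_normB _ _) _.
    rewrite [`|l * _|]ger0_norm ?mulr_ge0 ?subr_ge0// mulrDl addrA lerD2r.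
    exact: hV (le_trans st tT).
  apply: ae_imply dini => r hr /andP[r0 _] e e0.
  have [d d0 hd] := hr r0 e e0; exists d => // s rs srd.
  have := hd s rs srd; have : 0 <= c * V r * (s - r).
    by rewrite !mulr_ge0 ?subr_ge0// ltW.
  lra.
pose phi s := expR (c * s) * (V s - l / c).
set B := V 0 + l * T + l / c; set M := expR (c * T).
have M0 : 0 < M by exact: expR_gt0.
have lc0 : 0 <= l / c by rewrite divr_ge0// ltW.
have : phi T <= phi 0.
  apply: (@ac_nonincreasing K phi) => //.
    apply: (@abs_cont_on_dominated n g _ 0 T (M * C) (M * L + c * M * B)) => //.
      by rewrite mulr_ge0// ltW.
      have M0' := ltW M0; have c0' := ltW c0.
      have B0 : 0 <= B by rewrite /B !addr_ge0// mulr_ge0.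
      by rewrite addr_ge0// !mulr_ge0.
    move=> s t s0 st tT.
    have -> : phi t - phi s = expR (c * t) * (V t - V s) +
        (expR (c * t) - expR (c * s)) * (V s - l / c) by rewrite /phi; ring.
    apply: le_trans (ler_normD _ _) _; rewrite !normrM.
    have e1 : `|expR (c * t)| <= M.
      by rewrite ger0_norm ?expR_ge0// ler_expR ler_pM2l.
    have e2 : `|V s - l / c| <= B.
      have := Vbd s s0 (le_trans st tT); have := V0 s.
      have := ler_wpM2l l0 (le_trans st tT); have := mulr_ge0 l0 T0; have := V0 0.
      rewrite ler_norml /B; lra.
    have e3 := ler_pM (normr_ge0 _) (normr_ge0 _) e1 (hV s t s0 st tT).
    have e4 := ler_pM (normr_ge0 _) (normr_ge0 _) (expRB_le c0 st tT) e2.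
    rewrite -/M in e4; lra.
  apply: ae_imply dini => t ht /andP[t0 _].
  exact/dini_le_decay/ht.
rewrite /phi mulr0 expR0 mul1r mulNr expRN -/M => h.
have {}h : M^-1 * (M * (V T - l / c)) <= M^-1 * (V 0 - l / c).
  by rewrite ler_wpM2l// invr_ge0 ltW.
rewrite mulKf ?gt_eqF// in h.
lra.
Qed.

(** * The trajectory and the moving quasi-steady point *)

Section Trajectory.
Context {m n p : nat}.
Variables (S : 'M[K]_(m, n)) (f : 'cV[K]_n -> 'cV[K]_p -> 'cV[K]_n).
Variables (D : set 'cV[K]_n) (U : set 'cV[K]_p).
Variables (u : K -> 'cV[K]_p) (x : K -> 'cV[K]_n) (xs : 'cV[K]_p -> 'cV[K]_n).
Variables (c H eps : K).
Hypotheses (SS : S *m S^T = 1%:M).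
Hypotheses (df : forall w, U w -> forall y, differentiable (f ^~ w) y).
Hypotheses (convD : convex_set D) (c0 : 0 < c) (H0 : 0 <= H).
Hypotheses (contr : semi_contracting S f u D c) (pker : preserves_kernel S f u D).
Hypotheses (uU : forall t, 0 <= t -> U (u t)) (uac : loc_abs_cont u).
Hypothesis u_slow : {ae @lebesgue_measure K, forall t : K, 0 <= t ->
  derivable u t 1 /\ enorm ('D_1 u t) <= eps}.
Hypotheses (xsD : forall w, U w -> D (xs w)).
Hypothesis dxs : forall w, U w -> differentiable xs w.
Hypothesis xs0 : forall w, U w -> snorm S (f (xs w) w) = 0.
Hypothesis xsH : forall w, U w -> op_norm_to_snorm S (jac xs w) <= H.
Hypotheses (solx : solution f u x) (xD : forall t, 0 <= t -> D (x t)).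

(** The sign of [eps] is forced by the Lipschitz bound on [[0, 1]]. *)
Let eps0 : 0 <= eps.
Proof.
have := lipschitz_of_ae_derive_le uac u_slow (lexx 0) ler01.
by rewrite subr0 mulr1; apply: le_trans; exact: enorm_ge0.
Qed.

(** Expand [xs] at [u t]: the linear term costs [H * eps * |s - t|], since [u] is Lipschitz at every
    time, and [e / (C * eps + 1)] makes the remainder cost at most [e * |s - t|]. Both sides of [t]
    are covered, since the continuity required by [real_induction_le] is two-sided. *)
Lemma quasi_steady_local_lipschitz t : 0 <= t -> forall e, 0 < e ->
  exists2 d, 0 < d & forall s, 0 <= s -> `|s - t| < d ->
    enorm (S *m (xs (u s) - xs (u t))) <= (H * eps + e) * `|s - t|.
Proof.
move=> t0 e e0.
have [C C0 hC] := enorm_mulmx_bounded S.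
have C1 : 0 < C * eps + 1 by rewrite ltr_wpDl// mulr_ge0.
have E1 : 0 < eps + 1 by rewrite ltr_wpDl.
have [d d0 hd] := differentiable_enorm (dxs (uU t0)) (divr_gt0 e0 C1).
exists (d / (eps + 1)) => [|s s0]; first exact: divr_gt0.
rewrite ltr_pdivlMr// => std.
set k := u s - u t.
have kst : enorm k <= eps * `|s - t|.
  have [st|/ltW ts] := leP s t.
    rewrite distrC [`|_|]ger0_norm ?subr_ge0// /k enorm_distC.
    exact: lipschitz_of_ae_derive_le.
  by rewrite [`|_|]ger0_norm ?subr_ge0//; exact: lipschitz_of_ae_derive_le.
have := hd k; rewrite subrKC => {}hd.
have kd : enorm k < d by have := normr_ge0 (s - t); lra.
set r := xs (u s) - xs (u t) - jac xs (u t) *m k in hd.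
have -> : xs (u s) - xs (u t) = jac xs (u t) *m k + r by rewrite subrKC.
rewrite mulmxDr; apply: le_trans (enormD _ _) _.
have h1 : enorm (S *m (jac xs (u t) *m k)) <= H * enorm k.
  apply: le_trans (enorm_le_op_norm_to_snorm _ _ _) _.
  by apply: ler_wpM2r; [exact: enorm_ge0|exact/xsH/uU].
have h2 := ler_wpM2l C0 (hd kd).
have h3 := ler_wpM2l H0 kst.
have h4 : C * (e / (C * eps + 1) * enorm k) <= e * `|s - t|.
  apply: (@le_trans _ _ (C * (e / (C * eps + 1) * (eps * `|s - t|)))).
    by rewrite ler_wpM2l// ler_wpM2l// divr_ge0// ltW.
  have -> : C * (e / (C * eps + 1) * (eps * `|s - t|)) =
     (C * eps) / (C * eps + 1) * (e * `|s - t|) by ring.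
  by rewrite ler_piMl ?mulr_ge0 ?(ltW e0)// ler_pdivrMr// mul1r lerDl.
have := hC r; lra.
Qed.

(** The segment from [u a] to [u b] may leave [U], so the local estimate is propagated along time by
    [real_induction_le], with the linear function [H * eps * s] as [W]. *)
Lemma quasi_steady_lipschitz a b : 0 <= a -> a <= b ->
  enorm (S *m (xs (u b) - xs (u a))) <= H * eps * (b - a).
Proof.
move=> a0 ab.
pose phi s := enorm (S *m (xs (u s) - xs (u a))).
have phiB s t : `|phi s - phi t| <= enorm (S *m (xs (u s) - xs (u t))).
  apply: le_trans (ler_enorm_dist _ _) _.
  by rewrite -mulmxBr opprB addrA subrK.
have He : 0 <= H * eps by rewrite mulr_ge0.
have phia : phi a = 0 by rewrite /phi subrr mulmx0 enorm0.
have -> : enorm (S *m (xs (u b) - xs (u a))) = phi b - phi a by rewrite phia subr0.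
have ba1 : 0 < b - a + 1 by rewrite ltr_wpDl// subr_ge0.
apply/ler_addgt0Pr => e e0.
have e1 : 0 < e / (b - a + 1) by rewrite divr_gt0.
suff main : phi b - phi a <= H * eps * b - H * eps * a + e / (b - a + 1) * (b - a).
  apply: le_trans main _; rewrite -mulrBr lerD2l.
  by rewrite mulrAC ler_pdivrMr// ler_wpM2l ?(ltW e0)// lerDl.
apply: (@real_induction_le K phi (fun s => H * eps * s)) => //.
- move=> t /andP[at_ tb] e' e'0.
  have [d d0 hd] := quasi_steady_local_lipschitz (le_trans a0 at_) ltr01.
  have He1 : 0 < H * eps + 1 by rewrite ltr_wpDl.
  exists (Num.min d (e' / (H * eps + 1))) => [|s /andP[as_ sb]].
    by rewrite lt_min d0 divr_gt0.
  rewrite lt_min => /andP[h1]; rewrite ltr_pdivlMr// mulrC => h2.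
  apply: le_lt_trans (phiB s t) _; apply: le_lt_trans h2.
  exact: hd (le_trans a0 as_) h1.
- by move=> s t _ st _; rewrite ler_wpM2l.
- exact: ltW.
move=> t /andP[at_ tb].
have [d d0 hd] := quasi_steady_local_lipschitz (le_trans a0 at_) e1.
exists d => // s ts std sb; rewrite -mulrBr -mulrDl.
have st0 : 0 < s - t by rewrite subr_gt0.
apply: le_trans (ler_norm _) _; apply: le_trans (phiB s t) _.
rewrite -[X in _ <= _ * X]gtr0_norm//; apply: hd.
  by rewrite (le_trans (le_trans a0 at_))// ltW.
by rewrite gtr0_norm// ltrBlDl.
Qed.

(** The quasi-steady point is frozen at [q]: semi-contraction handles the motion of [x] relative to
    [q], and the drift of [xs (u s)] away from [q] adds [H * eps]. *)
Lemma dini_tracking_error t : 0 <= t -> derivable x t 1 ->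
  'D_1 x t = f (x t) (u t) ->
  right_upper_dini_le (fun s => enorm (S *m (x s - xs (u s)))) t
    (- c * enorm (S *m (x t - xs (u t))) + H * eps).
Proof.
move=> t0 dx xE e e0; have e2 : 0 < e / 2 by rewrite divr_gt0.
have Ut := uU t0; have Dxt := xD t0; have Dq := xsD Ut.
set q := xs (u t) in Dq *; set xi := S *m (x t - q).
have Sq : S *m f q (u t) = 0 by apply: enorm_eq0; exact: xs0.
have [C C0 hC] := enorm_mulmx_bounded S.
have C1 : 0 < C + 1 by rewrite ltr_wpDl.
have [d1 d10 hd1] := derivable_enorm dx (divr_gt0 e2 C1).
set zeta := S *m (f (x t) (u t) - f q (u t)).
have [d2 d20 hd2] : exists2 d, 0 < d & forall h, 0 < h -> h < d ->
    enorm (xi + h *: zeta) <= enorm xi + (- c * enorm xi + e / 2) * h.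
  apply: enorm_add_scale_le => //.
    exact: (semi_contracting_dot SS c0 convD t0 (df Ut) contr pker Dq Dxt).
  exact: (semi_contracting_ker convD t0 (df Ut) pker Dq Dxt).
exists (Num.min d1 d2) => [|s ts]; first by rewrite lt_min d10.
rewrite -ltrBlDl lt_min => /andP[s1 s2].
have st0 : 0 < s - t by rewrite subr_gt0.
have := hd1 s ts; rewrite -ltrBlDl => /(_ s1); rewrite xE.
set r := x s - x t - _ => hr.
have Hq := quasi_steady_lipschitz t0 (ltW ts); rewrite -/q in Hq.
have -> : x s - xs (u s) = (x t - q + (s - t) *: f (x t) (u t)) + r - (xs (u s) - q).
  rewrite /r opprB; apply/eqP; rewrite -subr_eq0; apply/eqP/matrixP => i j.
  by rewrite !mxE; ring.
rewrite mulmxBr mulmxDr mulmxDr -scalemxAr -/xi.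
(* [f q (u t)] need not vanish; it only lies in the kernel of [S]. *)
have <- : zeta = S *m f (x t) (u t) by rewrite /zeta mulmxBr Sq subr0.
have h1 := enormB (xi + (s - t) *: zeta + S *m r) (S *m (xs (u s) - q)).
have h2 := enormD (xi + (s - t) *: zeta) (S *m r).
have h3 := hd2 _ st0 s2.
have h4 : enorm (S *m r) <= e / 2 * (s - t).
  apply: le_trans (hC r) _; apply: le_trans (ler_wpM2l C0 hr) _.
  rewrite mulrA ler_wpM2r ?(ltW st0)//.
  by rewrite mulrCA ler_piMr// ?(ltW e2)// ler_pdivrMr// mul1r lerDl.
lra.
Qed.

(** Absolute continuity of the error comes from [x], with the Lipschitz term [H * eps] accounting
    for the quasi-steady point. *)
Lemma tracking_error_bound t : 0 <= t ->
  enorm (S *m (x t - xs (u t))) <=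
    expR (- c * t) * enorm (S *m (x 0 - xs (u 0))) +
    H * eps / c * (1 - expR (- c * t)).
Proof.
move=> t0; have [xac xode] := solx.
have [C C0 hC] := enorm_mulmx_bounded S.
have He : 0 <= H * eps by rewrite mulr_ge0.
apply: (@ac_gronwall n x (fun s => enorm (S *m (x s - xs (u s)))) c (H * eps) C
  (H * eps)) => // [s|r s r0 rs st|]; first exact: enorm_ge0.
  apply: le_trans (ler_enorm_dist _ _) _; rewrite -mulmxBr.
  have -> : x s - xs (u s) - (x r - xs (u r)) = (x s - x r) - (xs (u s) - xs (u r)).
    by rewrite !opprB addrACA [RHS]addrACA (addrC (- xs (u s))).
  rewrite mulmxBr; apply: le_trans (enormB _ _) _; apply: lerD; first exact: hC.
  exact: quasi_steady_lipschitz.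
apply: ae_imply xode => s hs s0; have [dx xE] := hs s0.
exact: dini_tracking_error.
Qed.

End Trajectory.
End Tracking.

(** * The matrix R and the asymptotic bound *)

Lemma Rmx_mul_tr (K : realType) N (Rth : 'M[K]_(N.-1, N)) :
  orthonormal_basis_ones_perp Rth -> Rmx Rth *m (Rmx Rth)^T = 1%:M.
Proof.
move=> [RR _]; rewrite /Rmx tr_block_mx mulmx_block !trmx0 trmx1 RR.
by rewrite !mulmx0 !mul0mx mulmx1 !addr0 !add0r -scalar_mx_block.
Qed.

Lemma limf_esup_le_decay (K : realType) (V : K -> K) (c r k : K) : 0 < c ->
  (forall t, 0 <= t -> V t <= expR (- c * t) * r + k * (1 - expR (- c * t))) ->
  (limf_esup (fun t => (V t)%:E) (pinfty_nbhs K) <= k%:E)%E.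
Proof.
move=> c0 hV; apply/lee_addgt0Pr => e e0; apply: ge_ereal_inf.
set Q := `|r - k| + 1; have Q0 : 0 < Q by rewrite ltr_wpDl.
(* On this ray [expR (c * t) >= 1 + c * t > Q / e], so the transient is at most [e]. The absolute
   value in [Q] covers both signs of [r - k], and the added 1 makes [Q] positive. *)
exists (ereal_sup [set (V t)%:E | t in [set t | Q / (c * e) < t]]).
  exists [set t | Q / (c * e) < t] => //=.
  by exists (Q / (c * e)); split; [exact: num_real|].
apply: ge_ereal_sup => _ [t /= tQ <-]; rewrite -EFinD lee_fin.
have ce0 : 0 < c * e by rewrite mulr_gt0.
have t0 : 0 < t by apply: lt_trans tQ; rewrite divr_gt0.
apply: le_trans (hV t (ltW t0)) _.
rewrite ltr_pdivrMr// in tQ.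
have ect : 0 < expR (c * t) by exact: expR_gt0.
have hE : expR (- c * t) * Q <= e.
  rewrite mulNr expRN mulrC ler_pdivrMr//.
  have := expR_ge1Dx (c * t); nra.
have : expR (- c * t) * (r - k) <= expR (- c * t) * Q.
  by rewrite ler_wpM2l ?expR_ge0// /Q (le_trans (ler_norm _))// lerDl.
lra.
Qed.

Theorem corollary3 (K : realType) (N : nat) (Rth : 'M[K]_(N.-1, N))
    (f : 'cV[K]_(N + N) -> 'cV[K]_(N + N) -> 'cV[K]_(N + N))
    (D U : set 'cV[K]_(N + N))
    (u x : K -> 'cV[K]_(N + N))
    (xs : 'cV[K]_(N + N) -> 'cV[K]_(N + N))
    (c H eps rho0 : K)
    (hN : (2 <= N)%N)
    (hRth : orthonormal_basis_ones_perp Rth)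
    (hf : forall w, U w -> C1_on setT (f ^~ w))
    (hD : convex_set D)
    (hc : 0 < c)
    (hcontr : semi_contracting (Rmx Rth) f u D c)
    (hker : preserves_kernel (Rmx Rth) f u D)
    (hu_U : forall t, 0 <= t -> U (u t))
    (hu_ac : loc_abs_cont u)
    (hu_slow : {ae @lebesgue_measure K, forall t : K, 0 <= t ->
       derivable u t 1 /\ enorm ('D_1 u t) <= eps})
    (hxsD : forall w, U w -> D (xs w))
    (hxsC1 : C1_on U xs)
    (hxs0 : forall w, U w -> snorm (Rmx Rth) (f (xs w) w) = 0)
    (hH : 0 < H)
    (hxsH : forall w, U w -> op_norm_to_snorm (Rmx Rth) (jac xs w) <= H)
    (hx : solution f u x)
    (hxD : forall t, 0 <= t -> D (x t))
    (hrho0 : ker_dist (Rmx Rth) (x 0) (xs (u 0)) <= rho0) :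
  (forall t, 0 <= t ->
     ker_dist (Rmx Rth) (x t) (xs (u t))
       <= expR (- c * t) * rho0 + H * eps / c * (1 - expR (- c * t)))
  /\ (limf_esup (fun t : K => (ker_dist (Rmx Rth) (x t) (xs (u t)))%:E)
        (pinfty_nbhs K) <= (H * eps / c)%:E)%E.
Proof.
have bound t : 0 <= t -> ker_dist (Rmx Rth) (x t) (xs (u t))
    <= expR (- c * t) * rho0 + H * eps / c * (1 - expR (- c * t)).
  move=> t0; rewrite ker_distE.
  have SS := Rmx_mul_tr hRth.
  have df w : U w -> forall y, differentiable (f ^~ w) y.
    by move=> /hf[h _] y; exact: h.
  apply: le_trans (tracking_error_bound SS df hD hc (ltW hH) hcontr hker hu_U hu_ac
    hu_slow hxsD hxsC1.1 hxs0 hxsH hx hxD t0) _.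
  by rewrite lerD2r ler_wpM2l ?expR_ge0// -ker_distE.
by split=> //; exact: (limf_esup_le_decay hc bound).
Qed.
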